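(* Let $\mathscr{X}$ be a finite state space. For any imprecise probabilities tree $(\overline{\mathrm{Q}}_s)_{s\in\mathscr{X}^{\ast}}$, with corresponding game-theoretic upper expectation $\overline{\mathrm{E}}_{\mathrm V}$, the following are equivalent: (a) $\overline{\mathrm{E}}_{\mathrm V}(f\vert x_{1:n})=\overline{\mathrm{Q}}_{x_{1:n}}(f(x_{1:n}\,\cdot))$ for all situations $x_{1:n}\in\mathscr{X}^{\ast}$ (of any length $n\in\mathbb{N}_0$) and all $(n+1)$-measurable variables $f\colon\Omega\to\overline{\mathbb{R}}$; (b) for every $s\in\mathscr{X}^{\ast}$, the local upper expectation $\overline{\mathrm{Q}}_s$ satisfies $\overline{\mathrm{Q}}_s(g)=\lim_{c\to-\infty}\overline{\mathrm{Q}}_s(g^{\vee c})$ for all $g\in\overline{\mathscr{L}}(\mathscr{X})$, where $g^{\vee c}(x)=\max\{g(x),c\}$.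
   Context: Notation: $\mathbb{N}=\{1,2,\dots\}$, $\mathbb{N}_0=\mathbb{N}\cup\{0\}$, $\overline{\mathbb{R}}=\mathbb{R}\cup\{-\infty,+\infty\}$, with conventions $+\infty-\infty=-\infty+\infty=+\infty$, $0\cdot(\pm\infty)=0$, $\inf\emptyset=+\infty$. For a non-empty set $\mathscr{Y}$, $\overline{\mathscr{L}}(\mathscr{Y})$ is the set of all maps $\mathscr{Y}\to\overline{\mathbb{R}}$ and $\overline{\mathscr{L}}_b(\mathscr{Y})$ the subset of those bounded below by a real constant. Limits and inequalities of functions are pointwise. Local models: $\mathscr{X}$ is a finite non-empty set. $\mathscr{X}^{\ast}=\bigcup_{n\in\mathbb{N}_0}\mathscr{X}^n$ is the set of situations (finite strings, including the empty string $\Box$). An imprecise probabilities tree assigns to each $s\in\mathscr{X}^{\ast}$ a map $\overline{\mathrm{Q}}_s\colon\overline{\mathscr{L}}(\mathscr{X})\to\overline{\mathbb{R}}$ that is an upper expectation, i.e. satisfies: (E1) $\overline{\mathrm{Q}}_s(c)=c$ for all $c\in\mathbb{R}$; (E2) $\overline{\mathrm{Q}}_s(f+g)\le\overline{\mathrm{Q}}_s(f)+\overline{\mathrm{Q}}_s(g)$ for all $f,g\in\overline{\mathscr{L}}_b(\mathscr{X})$; (E3) $\overline{\mathrm{Q}}_s(\lambda f)=\lambda\overline{\mathrm{Q}}_s(f)$ for all real $\lambda>0$ and $f\in\overline{\mathscr{L}}_b(\mathscr{X})$; (E4) $f\le g\Rightarrow\overline{\mathrm{Q}}_s(f)\le\overline{\mathrm{Q}}_s(g)$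 for all $f,g\in\overline{\mathscr{L}}_b(\mathscr{X})$; (E5) $\lim_n\overline{\mathrm{Q}}_s(f_n)=\overline{\mathrm{Q}}_s(\lim_n f_n)$ for every non-decreasing sequence $\{f_n\}_{n\in\mathbb{N}_0}$ of non-negative variables in $\overline{\mathscr{L}}_b(\mathscr{X})$. Global model: $\Omega=\mathscr{X}^{\mathbb{N}}$ is the set of paths; for $\omega\in\Omega$, $\omega^n\in\mathscr{X}^n$ is the string of its first $n$ values; $\Gamma(x_{1:n})=\{\omega\in\Omega:\omega^n=x_{1:n}\}$. For $g,h\colon\Omega\to\overline{\mathbb{R}}$, $g\ge_s h$ means $g(\omega)\ge h(\omega)$ for all $\omega\in\Gamma(s)$. A supermartingale is a map $\mathscr{M}\colon\mathscr{X}^{\ast}\to\overline{\mathbb{R}}$ with $\overline{\mathrm{Q}}_s(\mathscr{M}(s\,\cdot))\le\mathscr{M}(s)$ for all $s\in\mathscr{X}^{\ast}$, where $\mathscr{M}(s\,\cdot)\in\overline{\mathscr{L}}(\mathscr{X})$ is $x\mapsto\mathscr{M}(sx)$. $\overline{\mathbb{M}}_{\mathrm b}$ is the set of supermartingales bounded below by a real constant, and $\liminf\mathscr{M}(\omega)=\liminf_{n\to+\infty}\mathscr{M}(\omega^n)$. The game-theoretic upper expectation is, for all $f\colon\Omega\to\overline{\mathbb{R}}$ and $s\in\mathscr{X}^{\ast}$, \[\overline{\mathrm{E}}_{\mathrm V}(f\vert s)=\inf\{\mathscr{M}(s):\mathscr{M}\in\overline{\mathbb{M}}_{\mathrm b},\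 \liminf\mathscr{M}\ge_s f\}.\] A variable $f\colon\Omega\to\overline{\mathbb{R}}$ is $m$-measurable if $f(\omega)$ depends only on $\omega^m$; its constant value on $\Gamma(x_{1:m})$ is written $f(x_{1:m})$. For $x_{1:n}\in\mathscr{X}^n$ and $(n+1)$-measurable $f$, $f(x_{1:n}\,\cdot)\in\overline{\mathscr{L}}(\mathscr{X})$ is the map $x_{n+1}\mapsto f(x_{1:n+1})$. *)

(* Defs.v *)
(* MathComp-Analysis. *)
From HB Require Import structures.
From mathcomp Require Import all_boot all_order all_algebra.
From mathcomp Require Import all_classical all_reals all_analysis.

Set Implicit Arguments.
Unset Strict Implicit.
Unset Printing Implicit Defensive.

Import Order.TTheory GRing.Theory Num.Theory.
Import numFieldNormedType.Exports.

Local Open Scope classical_set_scope.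
Local Open Scope ring_scope.
Local Open Scope ereal_scope.

Definition bounded_from_below (R : realType) (Y : Type) (f : Y -> \bar R) :=
  exists c : R, forall y, c%:E <= f y.

(* The sums below are those of [ereal_dual_scope], where
   +oo + -oo = -oo + +oo = +oo. The variables [f n] in [UE_cvg] are bounded
   below by 0. *)
Record upper_expectation (R : realType) (X : finType)
    (Q : (X -> \bar R) -> \bar R) : Prop := UpperExpectation {
  UE_cst : forall c : R, Q (fun=> c%:E) = c%:E ;
  UE_subadd : forall f g, bounded_from_below f -> bounded_from_below g ->
    Q (fun x => (f x + g x)%dE) <= (Q f + Q g)%dE ;
  UE_homo : forall (l : R) f, (0 < l)%R -> bounded_from_below f ->
    Q (fun x => l%:E * f x) = l%:E * Q f ;
  UE_monotone : forall f g, bounded_from_below f -> bounded_from_below g ->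
    (forall x, f x <= g x) -> Q f <= Q g ;
  UE_cvg : forall f : nat -> X -> \bar R,
    (forall n x, 0 <= f n x) ->
    (forall n x, f n x <= f n.+1 x) ->
    Q (f n) @[n --> \oo] --> Q (fun x => limn (fun n => f n x)) }.

(* Situations are finite strings [seq X]. A path is w : nat -> X, whose k-th
   value (k >= 1) is [w k.-1]; [prefix_path w n] consists of its first n
   values. *)
Definition prefix_path (X : Type) (w : nat -> X) (n : nat) : seq X := mkseq w n.

Definition cylinder (X : Type) (s : seq X) : set (nat -> X) :=
  [set w | prefix_path w (size s) = s].

Definition supermartingale (R : realType) (X : finType)
    (Q : seq X -> (X -> \bar R) -> \bar R) (M : seq X -> \bar R) :=
  forall s, Q s (fun x => M (rcons s x)) <= M s.

Definition liminf_path (R : realType) (X : Type) (M : seq X -> \bar R)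
    (w : nat -> X) : \bar R :=
  limn_einf (fun n => M (prefix_path w n)).

Definition game_upper_expectation (R : realType) (X : finType)
    (Q : seq X -> (X -> \bar R) -> \bar R)
    (f : (nat -> X) -> \bar R) (s : seq X) : \bar R :=
  ereal_inf [set M s | M in [set M | [/\ supermartingale Q M,
    bounded_from_below M &
    forall w, cylinder s w -> f w <= liminf_path M w]]].

Definition n_measurable (R : realType) (X : Type) (m : nat)
    (f : (nat -> X) -> \bar R) :=
  forall w w', prefix_path w m = prefix_path w' m -> f w = f w'.

(* f(s x), evaluated on the path that starts with [rcons s x] and is equal to x
   from then on; by [local_sliceE] the choice of path in the cylinder is
   immaterial when f is (size s).+1-measurable. *)
Definition local_slice (R : realType) (X : Type) (f : (nat -> X) -> \bar R)
    (s : seq X) : X -> \bar R :=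
  fun x => f (nth x (rcons s x)).

Lemma local_sliceE (R : realType) (X : Type) (f : (nat -> X) -> \bar R)
    (s : seq X) (x : X) (w : nat -> X) :
  n_measurable (size s).+1 f -> cylinder (rcons s x) w ->
  f w = local_slice f s x.
Proof.
move=> mf; rewrite /cylinder /= size_rcons => ws; apply: mf.
by rewrite ws /prefix_path -(size_rcons s x) mkseq_nth.
Qed.

(* Main.v *)
(* For an (n+1)-measurable f with slice g = f(s .), the game-theoretic upper
   expectation E_V(f|s) equals inf_c Q_s(g \/ c), which is also the limit of
   Q_s(g \/ c) as c -> -oo by monotonicity; hence (a) and (b) say the same thing.
   The bound <= comes from the supermartingale that equals Q_s(g \/ c) at s,
   stays at g(x) \/ c from s x on, and is +oo off the subtree of s.
   For >=, let M be a supermartingale above the real c with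
   liminf M >= f on the cylinder of s. Since X is finite, from any situation one
   can always move to a child on which M does not increase; following such
   children from s x gives a path along which f = g(x) and
   liminf M <= M(s x). So M(s .) >= g \/ c, and
   M(s) >= Q_s(M(s .)) >= Q_s(g \/ c). *)
Require Import Defs.
From mathcomp Require Import all_boot all_order all_algebra.
From mathcomp Require Import all_classical all_reals all_analysis.
Set Implicit Arguments.
Unset Strict Implicit.
Unset Printing Implicit Defensive.
Import Order.TTheory GRing.Theory Num.Theory.
Import numFieldNormedType.Exports.
Local Open Scope classical_set_scope.
Local Open Scope ring_scope.
Local Open Scope ereal_scope.

Lemma limn_einf_ge (R : realType) (u : nat -> \bar R) (a : \bar R) (N : nat) :
  (forall n, (N <= n)%N -> a <= u n) -> a <= limn_einf u.
Proof.
move=> au; rewrite limn_einf_lim (cvg_lim _ (@cvg_einfs_sup _ u))//.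
apply: (@le_trans _ _ (einfs u N)); last by apply: ereal_sup_ubound; exists N.
by apply: le_ereal_inf_tmp => _ [n /= Nn <-]; exact: au.
Qed.

Lemma limn_einf_le (R : realType) (u : nat -> \bar R) (a : \bar R) (N : nat) :
  (forall n, (N <= n)%N -> u n <= a) -> limn_einf u <= a.
Proof.
move=> ua; rewrite limn_einf_lim (cvg_lim _ (@cvg_einfs_sup _ u))//.
apply: ge_ereal_sup => _ [n _ <-].
apply: (@le_trans _ _ (u (maxn n N))); last by rewrite ua// leq_maxr.
by apply: ereal_inf_lbound; exists (maxn n N) => //=; rewrite leq_maxl.
Qed.

(** The reflection $c\mapsto -c$ turns this into convergence of a non-increasing function at
    $+\infty$, with the same range. *)
Lemma nondecreasing_cvgeNy (R : realType) (F : R -> \bar R) :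
  (forall c d, (c <= d)%R -> F c <= F d) ->
  F c @[c --> -oo%R] --> ereal_inf (range F).
Proof.
move=> ndF; apply/cvgNy_compNP.
have -> : range F = range (F \o -%R%R).
  apply/seteqP; split=> _ [c _ <-]; last by exists (- c)%R.
  by exists (- c)%R => //=; rewrite opprK.
by apply: nonincreasing_cvge => c d cd; apply: ndF; rewrite lerN2.
Qed.

Lemma UE_ge_cst (R : realType) (X : finType) (Q : (X -> \bar R) -> \bar R)
    (f : X -> \bar R) (a : \bar R) :
  upper_expectation Q -> bounded_from_below f -> (forall x, a <= f x) ->
  a <= Q f.
Proof.
move=> UQ bf af.
have geQ (r : R) : r%:E <= a -> r%:E <= Q f.
  move=> ra; rewrite -(UE_cst UQ r); apply: (UE_monotone UQ) => //.
    by exists r.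
  by move=> x; exact: le_trans (af x).
case: a af geQ => [r| |] af geQ; rewrite ?leNye//; first exact: geQ.
(* (E1) speaks of real constants only, so for [a] $=+\infty$ the value [Q f] is shown to exceed
   every real. *)
by rewrite leye_eq; apply/eqP/eqyP => r _; apply: geQ; rewrite leey.
Qed.

Lemma UE_max_monotone (R : realType) (X : finType) (Q : (X -> \bar R) -> \bar R)
    (g : X -> \bar R) (c d : R) :
  upper_expectation Q -> (c <= d)%R ->
  Q (fun x => maxe (g x) c%:E) <= Q (fun x => maxe (g x) d%:E).
Proof.
move=> UQ cd; apply: (UE_monotone UQ).
- by exists c => x; rewrite le_max lexx orbT.
- by exists d => x; rewrite le_max lexx orbT.
- by move=> x; rewrite ge_max !le_max lexx lee_fin cd orbT.
Qed.

(** Each iterate extends the previous one, so its entry [k] never changes once present. The path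
    reads entry [k] off [str k.+1], which is long enough. *)
Lemma path_of_strategy (X : Type) (x0 : X) (next : seq X -> X) (s : seq X) :
  exists w : nat -> X, forall n : nat,
    Defs.prefix_path w (size s + n)%N = iter n (fun t => rcons t (next t)) s.
Proof.
pose str n := iter n (fun t => rcons t (next t)) s.
have sz n : size (str n) = (size s + n)%N.
  by elim: n => [|n IH]; rewrite ?addn0// /str iterS size_rcons IH addnS.
have stable n d k : (k < size s + n)%N ->
    nth x0 (str (n + d)%N) k = nth x0 (str n) k.
  move=> kn; elim: d => [|d IH]; first by rewrite addn0.
  rewrite addnS {1}/str iterS -/(str _) nth_rcons sz.
  by rewrite (leq_trans kn) ?IH// leq_add2l leq_addr.
exists (fun k => nth x0 (str k.+1) k) => n.
apply: (@eq_from_nth _ x0) => [|k]; rewrite size_mkseq ?sz// => kn.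
(* [str k.+1] and [str n] are both compared with their common extension [str (n + k.+1)]. *)
rewrite nth_mkseq// -(stable k.+1 n); first by rewrite addnC stable.
by rewrite addnS ltnS leq_addl.
Qed.

Section supermartingale_theory.
Context (R : realType) (X : finType) (Q : seq X -> (X -> \bar R) -> \bar R).
Hypothesis Q_upper : forall s : seq X, upper_expectation (Q s).

(** A child minimising [M] works: this minimum is at most [Q t] of the children's values, hence at
    most [M t]. *)
Lemma supermartingale_child_le (x0 : X) (M : seq X -> \bar R) (t : seq X) :
  supermartingale Q M -> bounded_from_below M ->
  exists x, M (rcons t x) <= M t.
Proof.
move=> sM [c cM].
have [x _ minx] := @Order.TotalTheory.arg_minP _ _ _ x0 xpredT
  (fun x => M (rcons t x)) isT.
exists x; apply: le_trans (sM t).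
by apply: UE_ge_cst => // [|y]; [exists c => y; exact: cM | exact: minx].
Qed.

Lemma supermartingale_path_le (x0 : X) (M : seq X -> \bar R) (s : seq X) :
  supermartingale Q M -> bounded_from_below M ->
  exists2 w, cylinder s w & liminf_path M w <= M s.
Proof.
move=> sM bM.
have [next nextP] := choice (fun t => supermartingale_child_le x0 t sM bM).
have [w wE] := path_of_strategy x0 next s.
exists w; first by have := wE 0%N; rewrite addn0.
apply: (@limn_einf_le _ _ _ (size s)) => n /subnKC <-; rewrite wE.
elim: (n - size s)%N => // k IH.
by rewrite iterS; exact: le_trans (nextP _) IH.
Qed.

(* The supermartingale witnessing E_V(f|s) <= Q_s(h), for h the slice of f at s
   cut off below. *)
Definition slice_supermartingale (s : seq X) (h : X -> \bar R) (t : seq X) :=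
  if prefix s t then if drop (size s) t is y :: _ then h y else Q s h else +oo.

Lemma slice_supermartingale_cat (s u : seq X) (h : X -> \bar R) :
  slice_supermartingale s h (s ++ u) = if u is y :: _ then h y else Q s h.
Proof. by rewrite /slice_supermartingale prefix_prefix drop_size_cat. Qed.

Lemma slice_supermartingaleP (s : seq X) (h : X -> \bar R) :
  bounded_from_below h -> supermartingale Q (slice_supermartingale s h).
Proof.
move=> [c ch] t; have [/prefixP[u ->]|nst] := boolP (prefix s t); last first.
  by rewrite [leRHS]/slice_supermartingale (negbTE nst) leey.
under eq_fun do rewrite rcons_cat slice_supermartingale_cat.
rewrite slice_supermartingale_cat; case: u => [|y u] /=.
  by rewrite cats0.
(* Strictly beyond [s] the process is constant: the value $-\infty$ is excluded by the lower bound,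
   $+\infty$ is trivial, and (E1) settles the reals. *)
case: (h y) (ch y) => [r _||]; rewrite ?leey//.
by rewrite (UE_cst (Q_upper _)).
Qed.

Lemma slice_supermartingale_bounded (s : seq X) (h : X -> \bar R) :
  bounded_from_below h -> bounded_from_below (slice_supermartingale s h).
Proof.
move=> [c ch]; exists c => t; rewrite /slice_supermartingale.
case: ifP => _; last exact: leey.
by case: drop => // ; apply: UE_ge_cst => //; exists c.
Qed.

Lemma slice_supermartingale_liminf (s : seq X) (h : X -> \bar R) w :
  cylinder s w -> h (w (size s)) <= liminf_path (slice_supermartingale s h) w.
Proof.
move=> ws; apply: (@limn_einf_ge _ _ _ (size s).+1) => n /subnKC <-.
rewrite addSnnS /Defs.prefix_path /mkseq iotaD map_cat [X in X ++ _]ws.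
by rewrite slice_supermartingale_cat.
Qed.

Lemma game_upper_expectation_slice (x0 : X) (s : seq X)
    (f : (nat -> X) -> \bar R) :
  n_measurable (size s).+1 f ->
  game_upper_expectation Q f s =
  ereal_inf (range (fun c : R => Q s (fun x => maxe (local_slice f s x) c%:E))).
Proof.
move=> mf; apply/eqP; rewrite eq_le; apply/andP; split.
  apply: le_ereal_inf_tmp => _ [c _ <-].
  set h := fun x => _.
  have bh : bounded_from_below h by exists c => x; rewrite le_max lexx orbT.
  apply: ereal_inf_lbound; exists (slice_supermartingale s h).
    split; [exact: slice_supermartingaleP|exact: slice_supermartingale_bounded|].
    move=> w ws; apply: le_trans (slice_supermartingale_liminf h ws).
    rewrite (@local_sliceE _ _ _ s (w (size s)) w) ?le_max ?lexx//.
    by rewrite /cylinder /= size_rcons /Defs.prefix_path mkseqS [mkseq _ _]ws.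
  by rewrite -{2}(cats0 s) slice_supermartingale_cat.
apply: le_ereal_inf_tmp => _ [M [sM bM fM] <-].
(* The cut-off level is the lower bound of [M] itself, so only the slice remains to be dominated. *)
have [c cM] := bM.
apply: le_trans (sM s); apply: ge_ereal_inf.
exists (Q s (fun x => maxe (local_slice f s x) c%:E)); first by exists c.
apply: (UE_monotone (Q_upper s)).
- by exists c => x; rewrite le_max lexx orbT.
- by exists c => x; exact: cM.
move=> x; rewrite ge_max cM andbT.
have [w wsx Mw] := supermartingale_path_le x0 (rcons s x) sM bM.
apply: le_trans Mw; rewrite -(local_sliceE mf wsx); apply: fM.
move: wsx; rewrite /cylinder /= size_rcons /Defs.prefix_path mkseqS.
by move=> /rcons_inj[].
Qed.

End supermartingale_theory.

Theorem corollary27 (R : realType) (X : finType) (X_gt0 : (0 < #|X|)%N)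
    (Q : seq X -> (X -> \bar R) -> \bar R)
    (Q_upper : forall s : seq X, upper_expectation (Q s)) :
  (forall (s : seq X) (f : (nat -> X) -> \bar R),
      n_measurable (size s).+1 f ->
      game_upper_expectation Q f s = Q s (local_slice f s))
  <->
  (forall (s : seq X) (g : X -> \bar R),
      Q s (fun x => maxe (g x) c%:E) @[c --> -oo%R] --> Q s g).
Proof.
have [x0 _] := card_gt0P X_gt0.
have cvgQ s g := nondecreasing_cvgeNy
  (fun c d => @UE_max_monotone R X (Q s) g c d (Q_upper s)).
split=> [QE s g|Qlim s f mf].
  (* Any [g] is thus the slice at [s] of a measurable variable. *)
  pose f w := g (w (size s)).
  have mf : n_measurable (size s).+1 f.
    move=> w w'; rewrite /Defs.prefix_path !mkseqS => /rcons_inj[_ ww'].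
    by rewrite /f ww'.
  have <- : local_slice f s = g.
    by apply/funext => x; rewrite /local_slice /f nth_rcons ltnn eqxx.
  by rewrite -QE// (game_upper_expectation_slice Q_upper x0 mf); exact: cvgQ.
rewrite (game_upper_expectation_slice Q_upper x0 mf).
(* Both values are limits of the same function at $-\infty$. *)
exact: cvg_unique (cvgQ s _) (Qlim s _).
Qed.
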